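(* For any finite simple graph $G$ we have \[\operatorname{dif}(G)\geq\max_{k\geq 1}\bigl(\delta_{2k}(G)-k+1\bigr),\] where the maximum is over integers $k\geq 1$ with $2k\leq |V(G)|$; that is, $\operatorname{dif}(G)\geq \delta_{2k}(G)-k+1$ for every such $k$.
   Context: For a finite simple graph $G$ and an injective labelling $f:V(G)\to\mathbb{Z}$, define $f_-(uv)=|f(u)-f(v)|$ for $uv\in E(G)$. The difference index $\operatorname{dif}(G)$ is the minimum, over all injective $f:V(G)\to\mathbb{Z}$, of the number of distinct values taken by $f_-$ on $E(G)$. For $1\leq j\leq |V(G)|$, $\delta_j(G)$ denotes the $j$th smallest vertex degree of $G$, i.e. the $j$th entry of the degree sequence of $G$ (with multiplicity) arranged in non-decreasing order. *)

(* Defs.v *)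
From mathcomp Require Import all_boot all_order all_algebra.
From mathcomp Require Import boolp.

Set Implicit Arguments.
Unset Strict Implicit.
Unset Printing Implicit Defensive.

Import Order.TTheory GRing.Theory Num.Theory.

(* A finite simple graph is a symmetric irreflexive relation [e] on a finite
   type of vertices [T]. *)

Definition degree (T : finType) (e : rel T) (u : T) : nat :=
  #|[set v | e u v]|.

Definition degree_sequence (T : finType) (e : rel T) : seq nat :=
  sort leq [seq degree e u | u <- enum T].

(* The index [j] is 1-based: only [1 <= j <= #|T|] is meaningful. *)
Definition delta (T : finType) (e : rel T) (j : nat) : nat :=
  nth 0 (degree_sequence e) j.-1.

(* Each edge occurs here as two ordered pairs, which carry the same value. *)
Definition edge_differences (T : finType) (e : rel T) (f : T -> int) :
    seq int :=
  [seq `|f p.1 - f p.2|%R | p <- enum {: T * T} & e p.1 p.2].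

Definition num_differences (T : finType) (e : rel T) (f : T -> int) : nat :=
  size (undup (edge_differences e f)).

Definition achieves_differences (T : finType) (e : rel T) : pred nat :=
  fun n => `[< exists f : T -> int, injective f /\ num_differences e f = n >].

Lemma achieves_differences_ex (T : finType) (e : rel T) :
  exists n, achieves_differences e n.
Proof.
pose f (u : T) : int := Posz (enum_rank u).
exists (num_differences e f); apply/asboolP; exists f; split=> //.
by move=> u v [/ord_inj/enum_rank_inj].
Qed.

Definition dif (T : finType) (e : rel T) : nat :=
  ex_minn (achieves_differences_ex e).

(* Main.v *)
(* Order the vertices by label.  A vertex with fewer than [k] vertices below it
   (or, symmetrically, above it) has degree less than [k] plus the number of
   differences, since its neighbours on the other side give distinct
   differences.  There are [2k] such extremal vertices, and fewer than [2k]
   vertices have degree below the [2k]-th smallest degree. *)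

Require Import Defs.
From mathcomp Require Import all_boot all_order all_algebra.
From mathcomp Require Import boolp zify.

Import Order.TTheory GRing.Theory Num.Theory.

(** By sortedness every entry from index [i] on is at least the entry at [i], so only the first [i]
    entries can be counted. *)
Lemma count_ltn_nth_sorted (s : seq nat) (i : nat) :
  sorted leq s -> i < size s -> count (fun y => y < nth 0 s i) s <= i.
Proof.
move=> s_sorted lt_i_s.
rewrite -[X in count _ X](cat_take_drop i s) count_cat.
have -> : count (fun y => y < nth 0 s i) (drop i s) = 0.
  apply/eqP; rewrite -leqn0 leqNgt -has_count; apply/hasPn => y.
  case/(nthP 0) => j; rewrite size_drop ltn_subRL => lt_j <-.
  rewrite nth_drop -leqNgt.
  by apply: (sorted_leq_nth leq_trans leqnn) => //; rewrite leq_addr.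
by rewrite addn0 (leq_trans (count_size _ _)) // size_take lt_i_s.
Qed.

Lemma card_degree_lt_delta (T : finType) (e : rel T) (j : nat) :
  0 < j <= #|T| -> #|[set u | degree e u < delta e j]| < j.
Proof.
(* The 1-based index [j.+1] reads entry [j] of the sequence, so at most [j] degrees are smaller;
   this makes the bound strict. *)
case: j => // j /andP[_ lt_j].
have size_ds : size (degree_sequence e) = #|T|.
  by rewrite size_sort size_map -cardT.
have ds_sorted : sorted leq (degree_sequence e).
  exact: (sort_sorted leq_total).
have := count_ltn_nth_sorted _ j ds_sorted; rewrite size_ds ltnS => /(_ lt_j).
apply: leq_trans; rewrite cardsE cardE /enum_mem size_filter.
rewrite [X in _ <= X]count_sort count_map.
by rewrite enumT.
Qed.

Section Labelling.
Variables (T : finType) (f : T -> int).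
Hypothesis f_inj : injective f.

Definition below (u : T) : {set T} := [set v | f v < f u]%R.
Definition above (u : T) : {set T} := [set v | f u < f v]%R.

Lemma card_below_above (u : T) : (#|below u| + #|above u|).+1 = #|T|.
Proof.
have := cardsC (u |: below u).
rewrite cardsU1 inE ltxx /= add1n addSn => <-; congr (_ + _).+1.
apply: eq_card => v; rewrite !inE.
by rewrite negb_or -leNgt lt_def (inj_eq f_inj).
Qed.

(** This count is the rank of [u] in the order of labels, and it grows strictly with the label. *)
Lemma card_below_inj : injective (fun u => #|below u|).
Proof.
have mono u v : (f u < f v)%R -> #|below u| < #|below v|.
  move=> lt_uv; apply: proper_card; apply/properP; split.
    by apply/subsetP => w; rewrite !inE => /lt_trans; apply.
  by exists u; rewrite inE ?ltxx.
move=> u v /= eq_uv; apply: f_inj; apply/eqP.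
by case: ltgtP => // /mono; rewrite eq_uv ltnn.
Qed.

Lemma card_extremal (k : nat) : 2 * k <= #|T| ->
  2 * k <= #|[set u | (#|below u| < k) || (#|above u| < k)]|.
Proof.
move=> le_k; set S := [set u | _].
suff : #|~: S| <= #|T| - 2 * k by have := cardsC S; lia.
(* A vertex outside [S] has at least [k] vertices on each side, so its rank lies in the interval
   from [k] to [#|T| - k - 1]; ranks are distinct. *)
rewrite cardE -(size_map (fun u => #|below u|)) -(size_iota k (#|T| - 2 * k)).
apply: uniq_leq_size; first by rewrite map_inj_uniq ?enum_uniq //; exact: card_below_inj.
move=> _ /mapP[u + ->]; rewrite mem_enum /S !inE mem_iota.
by have := card_below_above u; lia.
Qed.

Variable e : rel T.

Lemma leq_card_neighbours (u : T) (A : {set T}) :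
    {in A, forall v, e u v} ->
    {in A &, injective (fun v => `|f u - f v|%R)} ->
  #|A| <= num_differences e f.
Proof.
move=> eA injA; rewrite cardE -(size_map (fun v => `|f u - f v|%R)).
apply: uniq_leq_size.
  rewrite map_inj_in_uniq ?enum_uniq // => v w; rewrite !mem_enum.
  exact: injA.
move=> _ /mapP[v + ->]; rewrite mem_enum mem_undup => /eA euv.
by apply/mapP; exists (u, v) => //; rewrite mem_filter mem_enum euv.
Qed.

(** Neighbours not below [u] have labels at least [f u], so the absolute value opens with one fixed
    sign and the difference determines the neighbour. *)
Lemma degree_le_below (u : T) :
  degree e u <= #|below u| + num_differences e f.
Proof.
rewrite /degree -(cardsID (below u)) leq_add //.
  by rewrite subset_leq_card ?subsetIr.
apply: (@leq_card_neighbours u) => [v|v w]; rewrite !inE -?leNgt.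
  by case/andP.
by move=> /andP[le_uv _] /andP[le_uw _] eq_vw; apply: f_inj; lia.
Qed.

Lemma degree_le_above (u : T) :
  degree e u <= #|above u| + num_differences e f.
Proof.
rewrite /degree -(cardsID (above u)) leq_add //.
  by rewrite subset_leq_card ?subsetIr.
apply: (@leq_card_neighbours u) => [v|v w]; rewrite !inE -?leNgt.
  by case/andP.
by move=> /andP[le_uv _] /andP[le_uw _] eq_vw; apply: f_inj; lia.
Qed.

End Labelling.

Theorem theorem3p1 (T : finType) (e : rel T)
    (e_sym : symmetric e) (e_irr : irreflexive e)
    (k : nat) (k_ge1 : (1 <= k)%N) (k_le : (2 * k <= #|T|)%N) :
  ((delta e (2 * k))%:Z - k%:Z + 1 <= (dif e)%:Z)%R.
Proof.
rewrite /dif; case: ex_minnP => _ /asboolP[f [f_inj <-]] _.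
have lt_small : #|[set u | degree e u < delta e (2 * k)]| < 2 * k.
  by apply: card_degree_lt_delta; lia.
have /subsetPn[u] : ~~ ([set u | (#|below _ f u| < k) || (#|above _ f u| < k)]
                        \subset [set u | degree e u < delta e (2 * k)]).
  apply: contraTN lt_small => /subset_leq_card; rewrite -leqNgt.
  exact/leq_trans/card_extremal.
rewrite !inE -leqNgt.
have := degree_le_below _ _ f_inj e u.
have := degree_le_above _ _ f_inj e u.
(* One side of [u] has at most [k - 1] vertices, which is the source of the [+ 1]. *)
lia.
Qed.
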